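(* Let $r\ge 2$ be a fixed integer and let $H$ be an $r$-uniform hypergraph on $n$ vertices of girth $6$, i.e. $H$ contains no Berge cycle of length less than six. Then $$|E(H)| \le (1+o(1))\frac{n^{3/2}}{r^{3/2}(r-1)},$$ where $o(1)$ denotes a quantity tending to $0$ as $n\to\infty$ (with $r$ fixed).
   Context: A Berge cycle of length $k\ge 2$ in a hypergraph is a sequence of $k$ distinct vertices $v_1,\dots,v_k$ and $k$ distinct hyperedges $h_1,\dots,h_k$ such that $v_i,v_{i+1}\in h_i$ for all $i$ (indices modulo $k$). In particular, having no Berge cycle of length $2$ means any two hyperedges share at most one vertex. *)

(* Defs.v *)
From mathcomp Require Import all_boot all_order all_algebra.
From mathcomp Require Import all_classical all_reals all_analysis.

Set Implicit Arguments.
Unset Strict Implicit.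
Unset Printing Implicit Defensive.

(* A hypergraph on the finite vertex set V is given by its edge set
   E : {set {set V}} (no repeated hyperedges). *)
Definition uniform (V : finType) (r : nat) (E : {set {set V}}) : Prop :=
  forall e : {set V}, e \in E -> #|e| = r.

(* [ordS] is the cyclic successor of 'I_k, i.e. i |-> i + 1 mod k. *)
Definition berge_cycle (V : finType) (E : {set {set V}}) (k : nat)
    (v : 'I_k -> V) (h : 'I_k -> {set V}) : Prop :=
  [/\ (2 <= k)%N, injective v, injective h, forall i, h i \in E
    & forall i, v i \in h i /\ v (ordS i) \in h i].

Definition has_berge_cycle (V : finType) (E : {set {set V}}) (k : nat) : Prop :=
  exists (v : 'I_k -> V) (h : 'I_k -> {set V}), berge_cycle E v h.

(* "Girth g" means that no Berge cycle is shorter than g; one of length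
   exactly g need not exist. *)
Definition no_berge_cycle_lt (V : finType) (E : {set {set V}}) (g : nat) : Prop :=
  forall k : nat, (k < g)%N -> ~ has_berge_cycle E k.

(* Main.v *)
Require Import Defs.
From mathcomp Require Import all_boot all_order all_algebra.
From mathcomp Require Import all_classical all_reals all_analysis.
From mathcomp Require Import ring lra.

(* Fix a hyperedge h. Leave it at a vertex v through an edge e <> h to a vertex
   x, then leave e at x through an edge f <> e to a vertex z. Two such walks
   with the same end z would close up, through h, to a Berge cycle of length at
   most 5, so h starts at most n of them. Summing over h, with d the degree
   and m = |E|,
     (r - 1) * sum over ordered pairs (v, x) in an edge of (d v - 1) (d x - 1)
       <= m n.
   For the lower bound put l = r m / n, the average degree. AM-GM gives
   d v * d x + l^3 / d v + l^3 / d x >= 3 l^2, and 1 / d v sums to at most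
   (r - 1) n over the pairs; replacing d by d - 1 costs only a term linear
   in l. The outcome r (r - 1)^2 (l^2 - O(l)) <= n is the theorem, with error
   O(n) in m. *)

Import Order.TTheory GRing.Theory Num.Theory.

(** For explicit lists the distinctness conditions become [uniq] goals that compute. Both indices
    stay below the size, so the defaults of [nth] never matter. *)
Lemma berge_cycle_of_seq {V : finType} (E : {set {set V}}) (vs : seq V)
    (hs : seq {set V}) :
  1 < size vs -> size hs = size vs -> uniq vs -> uniq hs ->
  {subset hs <= E} ->
  (forall (x : V) (i : nat), i < size vs ->
     nth x vs i \in nth finset.set0 hs i /\
     nth x vs (i.+1 %% size vs) \in nth finset.set0 hs i) ->
  has_berge_cycle E (size vs).
Proof.
case: vs => // x vs' + + + + hsE; set vs := x :: vs' => ? eq_sz uv uh inc.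
exists (fun i => nth x vs i), (fun i => nth finset.set0 hs i); split => //.
- by move=> i j /eqP; rewrite nth_uniq ?ltn_ord// => /eqP/val_inj.
- by move=> i j /eqP; rewrite nth_uniq ?eq_sz ?ltn_ord// => /eqP/val_inj.
- by move=> i; apply/hsE/mem_nth; rewrite eq_sz.
- by move=> i; apply: inc.
Qed.

(** * Closed walks of length at most five *)

Section Girth6.
Variables (V : finType) (E : {set {set V}}).
Hypothesis girth6 : no_berge_cycle_lt E 6.

Lemma linear_of_girth6 (e f : {set V}) (x y : V) :
  e \in E -> f \in E -> e != f -> x \in e -> x \in f -> y \in e -> y \in f ->
  x = y.
Proof.
move=> eE fE nef xe xf ye yf; apply/eqP/negPn/negP => nxy.
apply: (girth6 2) => //; apply: (@berge_cycle_of_seq _ _ [:: x; y] [:: e; f]) => //=.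
- by rewrite inE nxy.
- by rewrite inE nef.
- by move=> g; rewrite !inE => /orP[]/eqP->.
- by move=> ? [|[|]].
Qed.

Lemma no_closed_walk3 (e1 e2 e3 : {set V}) (x1 x2 x3 : V) :
  e1 \in E -> e2 \in E -> e3 \in E ->
  e1 != e2 -> e2 != e3 -> e3 != e1 -> x1 != x2 -> x2 != x3 -> x3 != x1 ->
  x1 \in e1 -> x2 \in e1 -> x2 \in e2 -> x3 \in e2 -> x3 \in e3 -> x1 \in e3 ->
  False.
Proof.
move=> E1 E2 E3 n12 n23 n31 m12 m23 m31 i1 i2 i3 i4 i5 i6.
apply: (girth6 3) => //.
apply: (@berge_cycle_of_seq _ _ [:: x1; x2; x3] [:: e1; e2; e3]) => //=.
- by rewrite !inE !negb_or m12 m23 eq_sym m31.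
- by rewrite !inE !negb_or n12 n23 eq_sym n31.
- by move=> g; rewrite !inE => /or3P[]/eqP->.
- by move=> ? [|[|[|]]].
Qed.

(** If e = g, then e and f share both x and y, against linearity. With its dual [vertex_skip], this
    spreads distinctness from consecutive terms of a walk to terms two apart. *)
Let edge_skip (e f g : {set V}) (x y : V) :
  e \in E -> f \in E -> e != f -> x != y -> x \in e -> x \in f ->
  y \in f -> y \in g -> e != g.
Proof.
move=> eE fE nef nxy xe xf yf yg; apply: contra_neq nxy => eg.
by apply: (linear_of_girth6 _ _ _ _ eE fE nef) => //; rewrite eg.
Qed.

Let vertex_skip (x y z : V) (e f : {set V}) :
  e \in E -> f \in E -> e != f -> x != y -> x \in e -> y \in e -> y \in f ->
  z \in f -> x != z.
Proof.
move=> eE fE nef nxy xe ye yf zf; apply: contra_neq nxy => xz.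
by apply: (linear_of_girth6 _ _ _ _ eE fE nef) => //; rewrite xz.
Qed.

(** On a cycle of length 4 or 5 any two positions are at most two apart, so the skip lemmas turn the
    closed walk into a Berge cycle. *)
Lemma no_closed_walk4 (e1 e2 e3 e4 : {set V}) (x1 x2 x3 x4 : V) :
  e1 \in E -> e2 \in E -> e3 \in E -> e4 \in E ->
  e1 != e2 -> e2 != e3 -> e3 != e4 -> e4 != e1 ->
  x1 != x2 -> x2 != x3 -> x3 != x4 -> x4 != x1 ->
  x1 \in e1 -> x2 \in e1 -> x2 \in e2 -> x3 \in e2 ->
  x3 \in e3 -> x4 \in e3 -> x4 \in e4 -> x1 \in e4 -> False.
Proof.
move=> E1 E2 E3 E4 n12 n23 n34 n41 m12 m23 m34 m41 i1 i2 i3 i4 i5 i6 i7 i8.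
have n13 : e1 != e3 by apply: (edge_skip _ e2 _ x2 x3).
have n24 : e2 != e4 by apply: (edge_skip _ e3 _ x3 x4).
have m13 : x1 != x3 by apply: (vertex_skip _ x2 _ e1 e2).
have m24 : x2 != x4 by apply: (vertex_skip _ x3 _ e2 e3).
apply: (girth6 4) => //.
apply: (@berge_cycle_of_seq _ _ [:: x1; x2; x3; x4] [:: e1; e2; e3; e4]) => //=.
- by rewrite !inE !negb_or m12 m23 m34 m13 m24 eq_sym m41.
- by rewrite !inE !negb_or n12 n23 n34 n13 n24 eq_sym n41.
- by move=> g; rewrite !inE => /or4P[]/eqP->.
- by move=> ? [|[|[|[|]]]].
Qed.

Lemma no_closed_walk5 (e1 e2 e3 e4 e5 : {set V}) (x1 x2 x3 x4 x5 : V) :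
  e1 \in E -> e2 \in E -> e3 \in E -> e4 \in E -> e5 \in E ->
  e1 != e2 -> e2 != e3 -> e3 != e4 -> e4 != e5 -> e5 != e1 ->
  x1 != x2 -> x2 != x3 -> x3 != x4 -> x4 != x5 -> x5 != x1 ->
  x1 \in e1 -> x2 \in e1 -> x2 \in e2 -> x3 \in e2 -> x3 \in e3 ->
  x4 \in e3 -> x4 \in e4 -> x5 \in e4 -> x5 \in e5 -> x1 \in e5 -> False.
Proof.
move=> E1 E2 E3 E4 E5 n12 n23 n34 n45 n51 m12 m23 m34 m45 m51.
move=> i1 i2 i3 i4 i5 i6 i7 i8 i9 i10.
have n13 : e1 != e3 by apply: (edge_skip _ e2 _ x2 x3).
have n24 : e2 != e4 by apply: (edge_skip _ e3 _ x3 x4).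
have n35 : e3 != e5 by apply: (edge_skip _ e4 _ x4 x5).
have n41 : e4 != e1 by apply: (edge_skip _ e5 _ x5 x1).
have n52 : e5 != e2 by apply: (edge_skip _ e1 _ x1 x2).
have m13 : x1 != x3 by apply: (vertex_skip _ x2 _ e1 e2).
have m24 : x2 != x4 by apply: (vertex_skip _ x3 _ e2 e3).
have m35 : x3 != x5 by apply: (vertex_skip _ x4 _ e3 e4).
have m41 : x4 != x1 by apply: (vertex_skip _ x5 _ e4 e5).
have m52 : x5 != x2 by apply: (vertex_skip _ x1 _ e5 e1).
apply: (girth6 5) => //.
apply: (@berge_cycle_of_seq _ _
  [:: x1; x2; x3; x4; x5] [:: e1; e2; e3; e4; e5]) => //=.
- rewrite !inE !negb_or m12 m23 m34 m45 m13 m24 m35.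
  by rewrite (eq_sym x1 x4) (eq_sym x1 x5) (eq_sym x2 x5) m41 m51 m52.
- rewrite !inE !negb_or n12 n23 n34 n45 n13 n24 n35.
  by rewrite (eq_sym e1 e4) (eq_sym e1 e5) (eq_sym e2 e5) n41 n51 n52.
- by move=> g; rewrite !inE => /orP[/eqP->|/or4P[]/eqP->].
- by move=> ? [|[|[|[|[|]]]]].
Qed.

(* The walk h, v, e, x, f, z of the header. *)
Definition escape (h e : {set V}) (v x : V) (f : {set V}) (z : V) : bool :=
  [&& [&& e \in E, e != h, v \in e & v \in h], (x \in e) && (x != v),
      [&& f \in E, f != e & x \in f] & (z \in f) && (z != x)].

(** Following one walk back from z and the other forward from h gives a closed walk of length 5.
    Where corresponding terms coincide it is cut short; its consecutive terms stay distinct, so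
    lengths 4 and 3 are excluded as well, and length 2 by linearity. *)
Lemma escape_inj (h e e' f f' : {set V}) (v v' x x' z : V) :
  h \in E -> escape h e v x f z -> escape h e' v' x' f' z ->
  [/\ e = e', v = v', x = x' & f = f'].
Proof.
move=> hE /and4P[/and4P[eE neh ve vh] /andP[xe nxv] /and3P[fE nfe xf] /andP[zf nzx]].
move=> /and4P[/and4P[eE' neh' ve' vh'] /andP[xe' nxv'] /and3P[fE' nfe' xf'] /andP[zf' nzx']].
have [?|nvv] := eqVneq v v'; last first.
  exfalso; have [?|nff] := eqVneq f f'; last first.
    by apply: (no_closed_walk5 f e h e' f' z x v v' x'); rewrite // eq_sym.
  subst f'; have [?|nxx] := eqVneq x x'; last first.
    by apply: (no_closed_walk4 f e h e' x' x v v'); rewrite // eq_sym.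
  subst x'; have [?|nee] := eqVneq e e'; last first.
    by apply: (no_closed_walk3 e h e' x v v'); rewrite // eq_sym.
  by subst e'; move/eqP: nvv; apply; apply: (linear_of_girth6 e h).
subst v'; have [?|nee] := eqVneq e e'; last first.
  exfalso; have [?|nff] := eqVneq f f'; last first.
    by apply: (no_closed_walk4 f e e' f' z x v x'); rewrite // eq_sym.
  subst f'; have [?|nxx] := eqVneq x x'; last first.
    by apply: (no_closed_walk3 f e e' x' x v); rewrite // eq_sym.
  by subst x'; move/eqP: nxv; apply; apply: (linear_of_girth6 e e').
subst e'; have [?|nff] := eqVneq f f'; last first.
  exfalso; have [?|nxx] := eqVneq x x'; last first.
    by apply: (no_closed_walk3 f e f' z x x'); rewrite // eq_sym.
  by subst x'; move/eqP: nzx; apply; apply: (linear_of_girth6 f f').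
by subst f'; split => //; apply: (linear_of_girth6 f e).
Qed.

(** * Degrees and the count of walks *)

Definition degree (v : V) : nat := #|[set e in E | v \in e]|.

(** The nested sum counts tuples (e, v, x, f, z), and by [escape_inj] the projection to z is
    injective on them. *)
Lemma sum_escape_le (h : {set V}) : h \in E ->
  \sum_(e in E | e != h) \sum_(v in e | v \in h) \sum_(x in e | x != v)
    \sum_(f in E | (f != e) && (x \in f)) \sum_(z in f | z != x) 1 <= #|V|.
Proof.
move=> hE; rewrite !pair_big_dep /= sum1_card.
apply: (@leq_trans #|[set p : {set V} * V * V * {set V} * V |
  escape h p.1.1.1.1 p.1.1.1.2 p.1.1.2 p.1.2 p.2]|).
  apply/subset_leq_card/fintype.subsetP => -[[[[e v] x] f] z] /=.
  by rewrite !inE /escape /= !unfold_in /= -!andbA.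
rewrite -(card_in_imset (f := snd)) ?max_card//.
move=> [[[[e v] x] f] z] [[[[e' v'] x'] f'] z']; rewrite !inE /= => H H' zz.
rewrite -zz in H' *.
by have [-> -> -> ->] := escape_inj _ _ _ _ _ _ _ _ _ _ hE H H'.
Qed.

Lemma card_other_edges (e : {set V}) (x : V) : e \in E -> x \in e ->
  #|[set f in E | (f != e) && (x \in f)]| = (degree x).-1.
Proof.
move=> eE xe; rewrite /degree [in RHS](cardsD1 e) !inE eE xe /=.
by apply: eq_card => f; rewrite !inE andbCA.
Qed.

Section Uniform.
Variable r : nat.
Hypothesis unifE : uniform r E.

Lemma card_other_vertices (e : {set V}) (v : V) : e \in E -> v \in e ->
  #|[pred x in e | x != v]| = r.-1.
Proof.
move=> eE ve; rewrite -(unifE e eE) (cardD1 v e) ve /=.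
by apply: eq_card => x; rewrite !inE andbC.
Qed.

Lemma sum_degrees_le :
  r.-1 * \sum_(e in E) \sum_(v in e) \sum_(x in e | x != v)
    (degree v).-1 * (degree x).-1 <= #|E| * #|V|.
Proof.
rewrite -sum_nat_const; apply: leq_trans (leq_sum _ sum_escape_le).
(* The sum over h moves inside those over e and v. For fixed e, v, x there are then d v - 1 choices
   of h, d x - 1 of f, and r - 1 of z for each f. *)
rewrite [leqRHS](exchange_big_dep (mem E)) /=; last by move=> h e _ /andP[].
rewrite big_distrr /=; apply: leq_sum => e eE.
rewrite [leqRHS](exchange_big_dep (mem e)) /=; last by move=> h v _ /andP[].
rewrite big_distrr /=; apply: leq_sum => v ve.
rewrite sum_nat_const -big_distrr /= mulnCA.
rewrite [X in X * _ <= _](_ : _ = #|[pred h |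
    [&& [&& h \in E, e \in E & e != h], v \in e & v \in h]]|); last first.
  rewrite -(card_other_edges _ _ eE ve); apply: eq_card => h.
  by rewrite !inE eE ve eq_sym -andbA.
rewrite leq_mul2l big_distrr /=; apply/orP; right.
apply: leq_sum => x /andP[xe _].
rewrite mulnC -(card_other_edges _ _ eE xe) -sum_nat_const.
apply: eq_leq; apply: eq_big => [f|f /[!inE] /and3P[fE _ xf]].
  by rewrite !inE.
by rewrite sum1_card card_other_vertices.
Qed.

Local Open Scope ring_scope.

Lemma degree_gt0 (e : {set V}) (v : V) : e \in E -> v \in e -> (0 < degree v)%N.
Proof. by move=> eE ve; apply/card_gt0P; exists e; rewrite inE eE. Qed.

(** A vertex v has r - 1 partners in each of its [degree v] edges, so its terms add up to r - 1, or
    to 0 if it lies in no edge. *)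
Lemma sum_inv_degree_le (R : realFieldType) :
  \sum_(e in E) \sum_(v in e) \sum_(x in e | x != v) (degree v)%:R^-1
    <= r.-1%:R * #|V|%:R :> R.
Proof.
rewrite (exchange_big_dep predT) //= mulr_natr -sumr_const.
apply: ler_sum => v _.
under eq_bigr => e /andP[eE ve].
  rewrite sumr_const card_other_vertices //; over.
rewrite sumr_const -mulrnA mulnC mulrnA; apply: ler_wMn2r.
rewrite (_ : #|_| = degree v); last by apply: eq_card => e; rewrite !inE.
have [->|d0] := eqVneq (degree v) 0%N; first by rewrite mulr0n ler01.
by rewrite -(mulr_natr _^-1) mulVf ?pnatr_eq0.
Qed.

End Uniform.
End Girth6.

Local Open Scope ring_scope.

(** * The AM-GM inequality for a pair of degrees *)

Section RealInequality.
Variable R : realFieldType.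

(** AM-GM for (s t)^2, s and t, whose product is (s t)^3. When s and t lie on the same side of 1,
    both are at least as close to 1 as s t is; otherwise (s - 1) (t - 1) is nonpositive. *)
Lemma three_mul_le (s t : R) : 0 < s -> 0 < t ->
  3 * (s * t) <= (s * t) ^+ 2 + s + t.
Proof.
move=> s0 t0; rewrite -subr_ge0.
have -> : (s * t) ^+ 2 + s + t - 3 * (s * t)
  = (s * t - 1) ^+ 2 - (s - 1) * (t - 1) by ring.
have [s1|/ltW s1] := leP s 1; have [t1|/ltW t1] := leP t 1.
- have : (1 - s) * (1 - t) <= (1 - s * t) * (1 - s * t).
    by apply: ler_pM; nra.
  by lra.
- by have := sqr_ge0 (s * t - 1); nra.
- by have := sqr_ge0 (s * t - 1); nra.
- have : (s - 1) * (t - 1) <= (s * t - 1) * (s * t - 1).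
    by apply: ler_pM; nra.
  by lra.
Qed.

(** This is [three_mul_le] at a / l and b / l, scaled by l^4 / (a b). *)
Lemma amgm_inv (l a b : R) : 0 < l -> 0 < a -> 0 < b ->
  3 * l ^+ 2 <= a * b + l ^+ 3 / a + l ^+ 3 / b.
Proof.
move=> l0 a0 b0.
have := three_mul_le (a / l) (b / l) (divr_gt0 a0 l0) (divr_gt0 b0 l0).
rewrite -(ler_pM2r (_ : 0 < l ^+ 4 / (a * b))); last first.
  by rewrite divr_gt0 ?mulr_gt0 ?exprn_gt0.
congr (_ <= _); field; rewrite !gt_eqF//.
Qed.

Lemma nonbacktracking_amgm (l a b : R) : 3 <= l -> 1 <= a -> 1 <= b ->
  3 * (l - 3) ^+ 2 <= (a - 1) * (b - 1) + l ^+ 3 / a + l ^+ 3 / b.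
Proof.
move=> l3 a1 b1.
have l0 : 0 < l by lra.
have small c : 1 <= c -> 3 * c <= l -> 3 * (l - 3) ^+ 2 <= l ^+ 3 / c.
  move=> c1 cl; rewrite ler_pdivlMr; last by lra.
  have : 3 * (l - 3) ^+ 2 <= 3 * l ^+ 2 by nra.
  have : 0 <= l ^+ 2 by rewrite sqr_ge0.
  rewrite (exprS l 2); nra.
have nng c : 1 <= c -> 0 <= l ^+ 3 / c.
  by move=> c1; rewrite divr_ge0 ?exprn_ge0 //; lra.
have ab0 : 0 <= (a - 1) * (b - 1) by rewrite mulr_ge0 ?subr_ge0.
have := nng a a1; have := nng b b1.
(* If a <= l / 3 or b <= l / 3, one of the fractions alone suffices; otherwise
   a - 1 >= (1 - 3 / l) a, likewise for b, and AM-GM applies. *)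
have [al|al] := leP (3 * a) l; first by have := small a a1 al; lra.
have [bl|bl] := leP (3 * b) l; first by have := small b b1 bl; lra.
move=> pb pa.
pose c := (l - 3) / l.
have c0 : 0 <= c by rewrite divr_ge0 //; lra.
have c1 : c <= 1 by rewrite ler_pdivrMr //; lra.
have scale d : l < 3 * d -> c * d <= d - 1.
  by move=> ld; rewrite /c mulrAC ler_pdivrMr //; nra.
have abE : c ^+ 2 * (a * b) <= (a - 1) * (b - 1).
  rewrite (_ : _ * _ = (c * a) * (c * b)); last by ring.
  by apply: ler_pM; rewrite ?scale // mulr_ge0 //; lra.
have lE : l - 3 = c * l by rewrite /c divfK // gt_eqF.
have := amgm_inv l a b l0 ltac:(lra) ltac:(lra).
have cc : c ^+ 2 <= 1 by rewrite expr_le1.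
have := sqr_ge0 c.
rewrite lE exprMn; nra.
Qed.

End RealInequality.

(** * The bound on the average degree *)

Lemma edges_le_weighted (R : realFieldType) (V : finType) (E : {set {set V}})
    (r : nat) (l : R) :
  no_berge_cycle_lt E 6 -> uniform r E -> 3 <= l ->
  3 * (l - 3) ^+ 2 * (r * r.-1 ^ 2 * #|E|)%:R <=
    (#|E| * #|V|)%:R + 2 * l ^+ 3 * (r.-1 ^ 2 * #|V|)%:R.
Proof.
move=> g6 unifE l3.
have := sum_degrees_le _ _ g6 _ unifE; rewrite -(ler_nat R) natrM.
move/(le_trans _) => le_count.
pose d v : R := (degree _ E v)%:R.
have d1 e v : e \in E -> v \in e -> 1 <= d v.
  by move=> eE ve; rewrite ler1n (degree_gt0 _ _ _ _ eE ve).
pose T (F : V -> V -> R) :=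
  \sum_(e in E) \sum_(v in e) \sum_(x in e | x != v) F v x.
have T1 : T (fun _ _ => 3 * (l - 3) ^+ 2) = 3 * (l - 3) ^+ 2 * (r * r.-1 * #|E|)%:R.
  rewrite /T; under eq_bigr => e eE.
    under eq_bigr => v ve do rewrite sumr_const (card_other_vertices _ _ _ unifE) //.
    rewrite sumr_const (unifE e eE); over.
  by rewrite sumr_const -!mulrnA mulr_natr; congr (_ *+ _); rewrite mulnCA mulnA.
have Tle : T (fun _ _ => 3 * (l - 3) ^+ 2) <=
   T (fun v x => (d v - 1) * (d x - 1)) + l ^+ 3 * T (fun v _ => (d v)^-1)
     + l ^+ 3 * T (fun _ x => (d x)^-1).
  rewrite /T !mulr_sumr -!big_split; apply: ler_sum => e eE /=.
  rewrite !mulr_sumr -!big_split; apply: ler_sum => v ve /=.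
  rewrite !mulr_sumr -!big_split; apply: ler_sum => x /andP[xe nxv] /=.
  by apply: nonbacktracking_amgm; rewrite ?(d1 e).
have Tv : T (fun v _ => (d v)^-1) <= r.-1%:R * #|V|%:R.
  exact: sum_inv_degree_le.
have Tx : T (fun _ x => (d x)^-1) = T (fun v _ => (d v)^-1).
  apply: eq_bigr => e _; rewrite (exchange_big_dep (mem e)) /=.
    by apply: eq_bigr => x xe; apply: eq_bigl => v; rewrite xe eq_sym.
  by move=> v x _ /andP[].
have Td : T (fun v x => (d v - 1) * (d x - 1)) =
  (\sum_(e in E) \sum_(v in e) \sum_(x in e | x != v)
    (degree _ E v).-1 * (degree _ E x).-1)%N%:R.
  rewrite natr_sum; apply: eq_bigr => e eE.
  rewrite natr_sum; apply: eq_bigr => v ve.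
  rewrite natr_sum; apply: eq_bigr => x /andP[xe _].
  by rewrite natrM -!subn1 !natrB ?(degree_gt0 _ _ _ _ eE).
have {Tle} := Tle; rewrite T1 Tx Td.
have := le_count _ (lexx _).
have r0 : 0 <= r.-1%:R :> R by [].
have l30 : 0 <= l ^+ 3 by rewrite exprn_ge0 //; lra.
move: Tv; set D := (\sum_(e in E) _)%N%:R; set I := T _.
rewrite !natrM; move: (#|E|%:R) (#|V|%:R) (r%:R) (r.-1%:R) r0 => m n p q q0.
move=> le1 le2 le3.
(* The factor r - 1 makes the degree sum the one bounded by [sum_degrees_le]. *)
have := ler_wpM2l q0 le3.
have := ler_wpM2l (mulr_ge0 q0 l30) le1.
lra.
Qed.

Lemma avg_degree_le (R : rcfType) (V : finType) (E : {set {set V}}) (r : nat)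
    (l : R) :
  (2 <= r)%N -> (0 < #|V|)%N -> no_berge_cycle_lt E 6 -> uniform r E ->
  l * #|V|%:R = r%:R * #|E|%:R ->
  l <= 18 + Num.sqrt #|V|%:R / (Num.sqrt r%:R * (r%:R - 1)).
Proof.
move=> r2 V0 g6 unifE lE.
have q0 : 0 < r%:R - 1 :> R by rewrite subr_gt0 ltr1n.
have r0 : 0 < r%:R :> R by rewrite ltr0n (ltn_trans _ r2).
have k0 : 0 < Num.sqrt r%:R * (r%:R - 1) :> R by rewrite mulr_gt0 ?sqrtr_gt0.
have n0 : 0 < #|V|%:R :> R by rewrite ltr0n.
have [l18|l18] := leP l 18; first by apply: ler_wpDr; rewrite // divr_ge0 ?sqrtr_ge0 ?ltW.
rewrite -lerBlDl ler_pdivlMr //.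
have := edges_le_weighted R V E r l g6 unifE ltac:(lra).
have -> : r.-1 = (r - 1)%N by rewrite subn1.
rewrite !natrM natrB ?(ltnW r2) // => H.
have lk0 : 0 <= (l - 18) * (Num.sqrt r%:R * (r%:R - 1)).
  by rewrite mulr_ge0 ?subr_ge0 ?ltW.
rewrite -(@ler_pXn2r _ 2) ?nnegrE ?sqrtr_ge0 //.
rewrite sqr_sqrtr ?(ltW n0) // !exprMn sqr_sqrtr ?(ltW r0) //.
move: lE H q0; move: (#|E|%:R) (#|V|%:R) n0 (r%:R - 1) => m n n0 q lE H q0.
(* After multiplication by r and substitution of l n for r m, every term contains the positive
   factor l n, which then cancels. *)
have {}H : (3 * (l - 3) ^+ 2 - 2 * l ^+ 2) * (r%:R * q ^+ 2) * (l * n) <= n * (l * n).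
  rewrite -(ler_pM2l r0) in H; move: H; rewrite !mulrDr.
  have -> : r%:R * (m * n) = n * (l * n) by rewrite mulrA -lE; ring.
  have -> : r%:R * (3 * (l - 3) ^+ 2 * (r%:R * (q * q) * m)) =
     3 * (l - 3) ^+ 2 * r%:R * (q ^+ 2) * (r%:R * m) by ring.
  by rewrite -lE; lra.
rewrite ler_pM2r in H; last by rewrite mulr_gt0 //; lra.
(* The constant 18 enters here: 3 (l - 3)^2 - 2 l^2 = l^2 - 18 l + 27 is at least (l - 18)^2 once l
   > 18. *)
apply: le_trans H; rewrite ler_wpM2r //; last by nra.
by rewrite mulr_ge0 ?sqr_ge0 ?ltW.
Qed.

(** * The asymptotic form *)

Import numFieldNormedType.Exports.
Local Open Scope classical_set_scope.

Lemma powR_3_2 (R : realType) (x : R) : 0 <= x -> x `^ (3 / 2) = x * Num.sqrt x.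
Proof.
rewrite le_eqVlt => /predU1P[<-|x0].
  by rewrite mul0r powR0 // mulf_neq0 ?invr_eq0.
have -> : 3 / 2 = 1 + 2^-1 :> R by lra.
by rewrite powRD ?(gt_eqF x0) ?implybT // powRr1 ?powR12_sqrt // ltW.
Qed.

Lemma cvg_sqrt_inv (R : realType) :
  Num.sqrt (n%:R^-1 : R) @[n --> \oo] --> (0 : R).
Proof.
rewrite -[X in _ --> X]sqrtr0.
apply: continuous_cvg; first exact: sqrt_continuous.
(* The harmonic sequence is 1 / (n + 1), hence the shift of the index. *)
by rewrite -(cvg_shiftS _); exact: cvg_harmonic.
Qed.

Theorem theorem2 (R : realType) (r : nat) (hr : (2 <= r)%N) :
  exists o : nat -> R,
    (o n @[n --> \oo] --> (0 : R)) /\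
    forall (n : nat) (V : finType) (E : {set {set V}}),
      #|V| = n -> uniform r E -> no_berge_cycle_lt E 6 ->
      (#|E|%:R : R) <=
        (1 + o n) * (n%:R `^ (3 / 2) / (r%:R `^ (3 / 2) * (r%:R - 1))).
Proof.
(* This is the additive error 18 n / r in m, divided by the main term n^(3/2) / (r^(3/2) (r -
   1)). *)
exists (fun n => 18 * Num.sqrt r%:R * (r%:R - 1) * Num.sqrt n%:R^-1); split.
  by rewrite -[X in _ --> X](mulr0 (18 * Num.sqrt r%:R * (r%:R - 1)));
    apply: cvgMr; exact: cvg_sqrt_inv.
move=> n V E cV unifE g6.
have r0 : 0 < r%:R :> R by rewrite ltr0n (ltn_trans _ hr).
have q0 : 0 < r%:R - 1 :> R by rewrite subr_gt0 ltr1n.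
rewrite !powR_3_2 //.
(* Without vertices there is no average degree, but there is also no edge, as an edge has r >= 2
   vertices. *)
have [n0|n0] := posnP n.
  rewrite n0 !mul0r mulr0 lern0 cards_eq0; apply/eqP/setP => e; rewrite inE.
  apply/negP => eE; have := max_card (mem e).
  by rewrite (unifE e eE) cV n0 leqn0 => /eqP re; rewrite re in hr.
have N0 : 0 < n%:R :> R by rewrite ltr0n.
have := avg_degree_le R V E r (r%:R * #|E|%:R / n%:R) hr.
rewrite cV => /(_ n0 g6 unifE); rewrite divfK ?gt_eqF // => /(_ erefl).
rewrite ler_pdivrMr // -ler_pdivlMl // => /le_trans; apply.
rewrite sqrtrV ?ler0n // le_eqVlt; apply/orP; left; apply/eqP.
have : Num.sqrt n%:R != 0 :> R by rewrite gt_eqF ?sqrtr_gt0.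
have : Num.sqrt r%:R != 0 :> R by rewrite gt_eqF ?sqrtr_gt0.
by move=> p0 s0; field; rewrite p0 s0 !gt_eqF.
Qed.
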